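(* Let $t$ be an integer with $m=2t+1\geq 11$, $n=2^m+1$, and $\delta_1=\frac{n}{3}$, $\delta_2=\frac{n-3}{6}$, $\delta_3=\delta_2-2$, $\delta_4=\delta_2-8$, $\delta_5=\delta_2-10$. Let $\delta$ be an odd integer. Then: (1) the narrow-sense BCH code $\mathcal{C}(n,2,\delta,1)$ has parameters $[n,\ n-m\delta+5m,\ d\geq\delta]$ if $2^{t+1}+3\leq\delta\leq 2^{t+1}+2^t-3$; $[n,\ n-m\delta+9m,\ d\geq\delta]$ if $2^{t+1}+2^t+3\leq\delta\leq 2^{t+2}-9$; $[n,\ n-2^{t+2}m+16m,\ d\geq 2^{t+2}+9]$ if $2^{t+2}-7\leq\delta\leq 2^{t+2}+9$; $[n,\ 2m(i-1)+3,\ d\geq\delta_i]$ if $\delta_{i+1}+2\leq\delta\leq\delta_i$ for some $i\in\{1,2,3,4\}$; $[n,1,n]$ if $\delta_1+2\leq\delta\leq n$. (2) the BCH code $\mathcal{C}(n,2,\delta+1,0)$ has parameters $[n,\ 2^m-m\delta+5m,\ d\geq2\delta]$ if $2^{t+1}+3\leq\delta\leq 2^{t+1}+2^t-3$; $[n,\ 2^m-m\delta+9m,\ d\geq2\delta]$ if $2^{t+1}+2^t+3\leq\delta\leq 2^{t+2}-9$; $[n,\ 2^m-2^{t+2}m+16m,\ d\geq 2(2^{t+2}+9)]$ if $2^{t+2}-7\leq\delta\leq 2^{t+2}+9$; $[n,\ 2m(i-1)+2,\ d\geq2\delta_i]$ if $\delta_{i+1}+2\leq\delta\leq\delta_i$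 for some $i\in\{1,2,3,4\}$.
   Context: For $n=2^m+1$ and an integer $x$, the 2-cyclotomic coset of $x$ modulo $n$ is $C_x=\{x\cdot 2^{j} \bmod n : j\geq 0\}\subseteq\{0,1,\dots,n-1\}$. Let $\xi$ be a primitive $n$-th root of unity in an extension field of $\mathbb{F}_2$. A binary cyclic code of length $n$ with generator polynomial $g(x)$ has defining set $\{i\in\{0,\dots,n-1\}: g(\xi^i)=0\}$ (a union of cosets $C_x$), and its dimension is $n$ minus the size of the defining set. $\mathcal{C}(n,2,\delta,1)$ denotes the binary cyclic code of length $n$ with defining set $C_1\cup C_2\cup\cdots\cup C_{\delta-1}$, and $\mathcal{C}(n,2,\delta+1,0)$ the one with defining set $C_0\cup C_1\cup\cdots\cup C_{\delta-1}$. $[n,k,d]$ denotes a linear code of length $n$, dimension $k$, minimum Hamming distance $d$. *)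

(* Defs.v *)
From HB Require Import structures.
From mathcomp Require Import all_boot all_order all_algebra.
Set Implicit Arguments. Unset Strict Implicit. Unset Printing Implicit Defensive.
Import GRing.Theory.
Local Open Scope ring_scope.

(* 2-cyclotomic coset of x modulo n, as a subset of {0,..,n-1}:
   C_x = { x * 2^j mod n : j >= 0 }.  Since the sequence x*2^j mod n is
   eventually periodic with period <= n and in fact purely periodic here
   (n odd), it suffices to let j range over j < n. *)
Definition cyc_coset (n x : nat) : {set 'I_n} :=
  [set i : 'I_n | [exists j : 'I_n, (i : nat) == (x * 2 ^ j) %% n]%N].

Definition bch_defset (n b delta : nat) : {set 'I_n} :=
  \bigcup_(x < delta.-1) cyc_coset n (b + x).

(* c(xi^i) for a binary word c = (c_0,...,c_(n-1)) viewed as c(x) = sum c_j x^j,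
   evaluated in a field F of characteristic 2 (which contains F_2). *)
Definition word_eval (F : fieldType) (n : nat) (xi : F) (c : 'rV['F_2]_n) (i : nat) : F :=
  \sum_(j < n) ((c ord0 j : nat)%:R * xi ^+ (i * j)).

Definition cyclic_code (F : fieldType) (n : nat) (xi : F) (D : {set 'I_n}) :
  {set 'rV['F_2]_n} :=
  [set c : 'rV['F_2]_n | [forall i : 'I_n, (i \in D) ==> (word_eval xi c i == 0)]].

Definition bch_code (F : fieldType) (n : nat) (xi : F) (delta b : nat) :
  {set 'rV['F_2]_n} :=
  cyclic_code xi (bch_defset n b delta).

Definition wt (n : nat) (c : 'rV['F_2]_n) : nat := #|[set j : 'I_n | c ord0 j != 0]|.

Definition code_dim (n : nat) (C : {set 'rV['F_2]_n}) : nat := \dim <<enum C>>%VS.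

Definition code_params_ge (n : nat) (C : {set 'rV['F_2]_n}) (k d0 : nat) : Prop :=
  code_dim C = k /\ (forall c, c \in C -> c != 0 -> (d0 <= wt c)%N).

Definition code_params_eq (n : nat) (C : {set 'rV['F_2]_n}) (k d : nat) : Prop :=
  code_params_ge C k d /\ (exists2 c, c \in C & (c != 0) && (wt c == d)).

Definition dlt (n i : nat) : nat :=
  match i with
  | 1 => n %/ 3
  | 2 => (n - 3) %/ 6
  | 3 => (n - 3) %/ 6 - 2
  | 4 => (n - 3) %/ 6 - 8
  | _ => (n - 3) %/ 6 - 10
  end%N.

(* Main.v *)
Require Import Defs.
From HB Require Import structures.
From mathcomp Require Import all_boot all_order all_algebra.
From mathcomp Require Import zify ring.

(** A word lies in the code with defining set [D] iff its polynomial is divisible by the product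
    of the [X - xi^i], [i] in [D]; when [D] is stable under doubling this product is fixed by
    Frobenius, so it descends to F_2 and the dimension is [n - #|D|].  Testing the syndromes
    against a polynomial vanishing on all support points but one gives the BCH bound, and
    since [2^m = -1] modulo [n] the zeros [1, .., d - 1] propagate to [-(d - 1), .., d - 1]
    when [0] is also a zero, which doubles the bound.

    For small [delta], write a coincidence [y 2^j = +-x] with [j <= t] (replacing [j] by [m - j]
    if needed): size and parity force [y 2^j = n +- x], whose odd solutions below [2^(t+2) - 7]
    involve only [2^(t+1) +- 1] and [2^(t+1) + 2^t +- 1].

    For large [delta], let [a] be the least element of a coset up to sign.  If [a > n / 6], the
    doubling map folded at [n / 2] swaps the two sides of its fixed point [n / 3] at each step,
    which is incompatible with the odd period [m] unless [a = n / 3].  The values just below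
    [n / 6] are settled by explicit multiples. *)

Set Implicit Arguments. Unset Strict Implicit. Unset Printing Implicit Defensive.
Import GRing.Theory.

(** * Dimension and BCH bound *)

Local Open Scope ring_scope.

Section Embedding.
Variables (F : fieldType) (hF : 2%N \in [pchar F]).

(** The map is additive only in characteristic 2, so a proof of the characteristic is an argument
    and the ring morphism instances can be attached to the term. *)
Definition F2_embed of 2%N \in [pchar F] := fun a : 'F_2 => (a : nat)%:R : F.

Lemma F2_embed_is_zmod_morphism : zmod_morphism (F2_embed hF).
Proof.
move=> a b; rewrite /F2_embed /= GRing.natr_mod_pchar // natrD.
rewrite GRing.natr_mod_pchar //.
rewrite natrB ?(ltnW (ltn_ord b)) //.
by rewrite (pcharf0 hF) sub0r.
Qed.

Lemma F2_embed_is_monoid_morphism : monoid_morphism (F2_embed hF).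
Proof.
by split=> // a b; rewrite /F2_embed /= GRing.natr_mod_pchar // natrM.
Qed.

HB.instance Definition _ :=
  GRing.isZmodMorphism.Build _ _ (F2_embed hF) F2_embed_is_zmod_morphism.
HB.instance Definition _ :=
  GRing.isMonoidMorphism.Build _ _ (F2_embed hF) F2_embed_is_monoid_morphism.

Lemma word_evalE n (xi : F) (c : 'rV['F_2]_n) i :
  word_eval xi c i = (map_poly (F2_embed hF) (rVpoly c)).[xi ^+ i].
Proof.
have -> : map_poly (F2_embed hF) (rVpoly c)
          = \poly_(j < n) (F2_embed hF (rVpoly c)`_j).
  apply/polyP=> j; rewrite coef_poly coef_map; case: ltnP => // nj.
  by rewrite nth_default ?rmorph0 // (leq_trans (size_poly _ _)).
rewrite horner_poly; apply: eq_bigr => j _.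
by rewrite coef_rVpoly_ord -exprM.
Qed.

(** A coefficient fixed by squaring is a root of a^2 - a, hence 0 or 1. *)
Lemma Frobenius_fixed_poly (p : {poly F}) :
  map_poly (pFrobenius_aut hF) p = p ->
  exists q : {poly 'F_2}, map_poly (F2_embed hF) q = p.
Proof.
move=> pE; exists (\poly_(i < size p) (p`_i != 0)%:R).
apply/polyP=> i; rewrite coef_map coef_poly.
have /eqP : (p`_i) ^+ 2 = p`_i by rewrite -[RHS](congr1 (fun q : {poly F} => q`_i) pE) coef_map.
rewrite -subr_eq0 expr2 -[X in _ - X]mulr1 -mulrBr mulf_eq0 subr_eq0.
case: ltnP => [_|/(nth_default 0)->]; last by rewrite raddf0.
by case/orP=> /eqP ->; rewrite ?eqxx ?oner_eq0 ?raddf0.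
Qed.

End Embedding.

Lemma coprime_modMl n a x y :
  coprime a n -> (a * x = a * y %[mod n] -> x = y %[mod n])%N.
Proof.
move=> co; wlog xy : x y / (y <= x)%N.
  by move=> H; case/orP: (leq_total y x) => /H // H1 /esym /H1.
move/eqP; rewrite eqn_mod_dvd ?leq_mul2l ?xy ?orbT // -mulnBr Gauss_dvdr.
  by rewrite -eqn_mod_dvd // => /eqP.
by rewrite coprime_sym.
Qed.

Lemma size_rVpoly (R : nzSemiRingType) d (v : 'rV[R]_d) : (size (rVpoly v) <= d)%N.
Proof. exact: size_poly. Qed.

Section Dimension.
Variables (F : fieldType) (hF : 2%N \in [pchar F]) (n : nat) (xi : F).
Hypothesis (hxi : n.-primitive_root xi) (oddn : odd n).
Variable D : {set 'I_n}.
Hypothesis D_double :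
  forall i j : 'I_n, i \in D -> (j : nat) = ((2 * i) %% n)%N -> j \in D.

Let roots := [seq xi ^+ i | i : 'I_n <- enum D].
Let g := \prod_(z <- roots) ('X - z%:P).

Let uniq_roots : uniq roots.
Proof.
rewrite map_inj_uniq ?enum_uniq // => i j /eqP.
by rewrite (eq_prim_root_expr hxi) !modn_small // => /eqP/val_inj.
Qed.

Let n_gt0 : (0 < n)%N. Proof. by case: (n) oddn. Qed.

(** Squaring doubles the exponents of the roots: it maps them into themselves by [D_double] and is
    injective because [n] is odd, so it permutes the factors of [g]. *)
Let map_Frobenius_g : map_poly (pFrobenius_aut hF) g = g.
Proof.
rewrite /g map_prod_XsubC -(big_map (pFrobenius_aut hF) xpredT (fun z => 'X - z%:P)).
have uniq_map : uniq [seq pFrobenius_aut hF z | z <- roots].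
  rewrite -map_comp map_inj_uniq ?enum_uniq // => i j /eqP.
  rewrite /= !pFrobenius_autE -!exprM (eq_prim_root_expr hxi) => /eqP.
  rewrite ![(_ * 2)%N]mulnC => /coprime_modMl; rewrite coprime2n !modn_small //.
  by move/(_ oddn)/val_inj.
apply/perm_big; apply: uniq_perm => //.
have [] // := @uniq_min_size _ [seq pFrobenius_aut hF z | z <- roots] roots.
- move=> _ /mapP[_ /mapP[i iD ->] ->].
  have lt2i : ((2 * i) %% n < n)%N by rewrite ltn_pmod.
  apply/mapP; exists (Ordinal lt2i).
    by rewrite mem_enum (D_double (i := i)) // -mem_enum.
  by rewrite pFrobenius_autE -exprM mulnC /= (prim_expr_mod hxi).
- by rewrite !size_map.
Qed.

(** The roots are distinct, so vanishing at all of them is divisibility by [g]; this divisibility is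
    insensitive to the passage from F_2 to [F]. *)
Lemma cyclic_code_dvdp : exists2 g0 : {poly 'F_2}, size g0 = #|D|.+1 &
  forall c : 'rV['F_2]_n, (c \in cyclic_code xi D) = (g0 %| rVpoly c).
Proof.
have [g0 g0E] := Frobenius_fixed_poly map_Frobenius_g.
exists g0.
  by rewrite -(size_map_poly (F2_embed hF)) g0E size_prod_XsubC size_map cardE.
move=> c; rewrite -(dvdp_map (F2_embed hF)) g0E inE.
apply/forallP/idP => [H | gc i].
  apply: uniq_roots_dvdp; last by rewrite uniq_rootsE.
  apply/allP=> _ /mapP[i iD ->]; rewrite rootE -word_evalE.
  by have /implyP := H i; apply; rewrite -mem_enum.
apply/implyP=> iD; rewrite (word_evalE hF); rewrite -rootE.
rewrite -dvdp_XsubCl; apply: dvdp_trans gc.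
rewrite dvdp_XsubCl root_prod_XsubC.
by apply: map_f; rewrite mem_enum.
Qed.

(** The code is the image of multiplication by the generator on polynomials of size at most
    [n - #|D|], an injective linear map. *)
Lemma code_dim_cyclic : code_dim (cyclic_code xi D) = (n - #|D|)%N.
Proof.
have [g0 sg0 memC] := cyclic_code_dvdp.
have g0_neq0 : g0 != 0 by rewrite -size_poly_eq0 sg0.
have leDn : (#|D| <= n)%N by rewrite -[X in (_ <= X)%N]card_ord max_card.
pose phi (v : 'rV['F_2]_(n - #|D|)) : 'rV['F_2]_n := poly_rV (rVpoly v * g0).
have phi_lin : linear phi.
  by move=> a u v; rewrite /phi linearP mulrDl -scalerAl linearP.
pose phiL : {linear _ -> _} := HB.pack phi (GRing.isLinear.Build _ _ _ _ phi phi_lin).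
have phiE v : linfun phiL v = phi v by rewrite lfunE.
have phiK v : rVpoly (phi v) = rVpoly v * g0.
  apply: poly_rV_K; apply: leq_trans (size_polyMleq _ _) _.
  rewrite sg0 addnS /=; apply: leq_trans (leq_add (size_rVpoly v) (leqnn _)) _.
  by rewrite subnK.
have -> : code_dim (cyclic_code xi D) = \dim (limg (linfun phiL)).
  congr (\dim _); apply/eqP; rewrite eqEsubv; apply/andP; split.
    apply/span_subvP=> c; rewrite mem_enum memC => /dvdpP[q qE].
    have -> : c = linfun phiL (poly_rV q).
      rewrite phiE /phi poly_rV_K; first by rewrite -qE rVpolyK.
      have [->|q_neq0] := eqVneq q 0; first by rewrite size_poly0.
      by have := size_rVpoly c; rewrite qE size_mul // sg0 addnS /= leq_subRL // addnC.
    by rewrite memv_img ?memvf.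
  apply/subvP=> _ /memv_imgP[v _ ->]; apply: memv_span.
  by rewrite mem_enum memC phiE phiK dvdp_mull.
have /eqP ker0 : lker (linfun phiL) == 0%VS.
  apply/lker0P=> u v; rewrite !phiE => /(congr1 rVpoly); rewrite !phiK.
  by move/(mulIf g0_neq0)/(can_inj rVpolyK).
by rewrite limg_dim_eq ?ker0 ?capv0 // dimvf dim_matrix mul1r.
Qed.

End Dimension.

Section BCHBound.
Variables (F : fieldType) (hF : 2%N \in [pchar F]) (n : nat) (xi : F).
Hypothesis hxi : n.-primitive_root xi.

(** Allows a run of consecutive zeros to wrap around past [n]. *)
Lemma word_eval_mod (c : 'rV['F_2]_n) i : word_eval xi c (i %% n) = word_eval xi c i.
Proof.
apply: eq_bigr => j _; congr (_ * _).
by rewrite -(prim_expr_mod hxi) modnMml (prim_expr_mod hxi).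
Qed.

(* Test the syndromes against the polynomial vanishing on all support points but one. *)
Lemma bch_bound (c : 'rV['F_2]_n) b d :
    c != 0 -> (forall k, (k < d.-1)%N -> word_eval xi c (b + k) = 0) ->
  (d <= wt c)%N.
Proof.
move=> c_neq0 zeros; rewrite leqNgt; apply/negP => lt_wt_d.
have [j0 cj0] : exists j0, c ord0 j0 != 0.
  by case/rV0Pn: c_neq0 => j; exists j.
pose S := [set j : 'I_n | c ord0 j != 0] :\ j0.
pose p := \prod_(z <- [seq xi ^+ j | j : 'I_n <- enum S]) ('X - z%:P).
(* [p] has [wt c - 1] roots, hence size [wt c], which is less than [d]. *)
have sp : (size p <= d.-1)%N.
  rewrite size_prod_XsubC size_map -cardE.
  have := cardsD1 j0 [set j : 'I_n | c ord0 j != 0].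
  by rewrite inE cj0 -/(wt c) -/S; lia.
(* Expanding [p] and exchanging the sums gives a combination of the syndromes at b, .., b + d - 2,
   which all vanish. *)
have : \sum_(j < n) (c ord0 j : nat)%:R * (xi ^+ (b * j) * p.[xi ^+ j]) = 0.
  transitivity (\sum_(j < n) \sum_(k < d.-1)
                  p`_k * ((c ord0 j : nat)%:R * xi ^+ ((b + k) * j))).
    apply: eq_bigr => j _; rewrite (horner_coef_wide _ sp) !mulr_sumr.
    apply: eq_bigr => k _; rewrite -exprM mulnDl exprD [(j * k)%N]mulnC; ring.
  rewrite exchange_big big1 //= => k _.
  by rewrite -mulr_sumr -/(word_eval xi c (b + k)) zeros ?mulr0.
(* Only the [j0] term survives, and none of its factors can be zero. *)
rewrite (bigD1 j0) //= big1 ?addr0 => [/eqP|j jj0]; last first.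
  have [->|cj] := eqVneq (c ord0 j) 0; first by rewrite mul0r.
  suff /rootP -> : root p (xi ^+ j) by rewrite !mulr0.
  by rewrite root_prod_XsubC; apply: map_f; rewrite mem_enum !inE jj0.
have xi_neq0 : xi != 0.
  apply/eqP=> xi0; have := prim_expr_order hxi.
  by rewrite xi0 expr0n gtn_eqF ?(prim_order_gt0 hxi) // => /eqP; rewrite eq_sym oner_eq0.
rewrite !mulf_eq0 expf_eq0 (negPf xi_neq0) andbF /=.
case/orP => [/eqP H|].
  by move/negP: cj0; apply; rewrite -(fmorph_eq0 (F2_embed hF)); apply/eqP.
rewrite -rootE root_prod_XsubC => /mapP[j]; rewrite mem_enum !inE => /andP[jj0 _] /eqP.
rewrite (eq_prim_root_expr hxi) !modn_small // => /eqP/val_inj jE.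
by rewrite jE eqxx in jj0.
Qed.

End BCHBound.

(** * Cyclotomic cosets *)

Local Open Scope nat_scope.

Definition same_coset n x y := exists j, y = x * 2 ^ j %[mod n].

(** Equality up to sign modulo [n]; the sum expresses the negative case without subtraction. *)
Definition eq_mod_opp n a b := a = b %[mod n] \/ n %| a + b.

Lemma card_nat_seq n (D : {set 'I_n}) (s : seq nat) :
  uniq s -> {in s, forall k, k < n} -> (forall i : 'I_n, (i \in D) = ((i : nat) \in s)) ->
  #|D| = size s.
Proof.
move=> us ltn Ds; rewrite cardE -(size_map val); apply: perm_size; apply: uniq_perm => //.
  by rewrite (map_inj_uniq val_inj) enum_uniq.
move=> k; apply/mapP/idP => [[i]|ks]; first by rewrite mem_enum Ds => ? ->.
by exists (Ordinal (ltn _ ks)); rewrite // mem_enum Ds.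
Qed.

Section Cosets.
Variables m n : nat.
Hypotheses (m_gt0 : 0 < m) (nE : n = 2 ^ m + 1).

Lemma n_odd : odd n.
Proof. by rewrite nE addn1 /= oddX orbF -lt0n m_gt0. Qed.

Lemma coprime_2n j : coprime (2 ^ j) n.
Proof. by rewrite coprimeXl // coprime2n n_odd. Qed.

Lemma mul2X_inj j x y : x * 2 ^ j = y * 2 ^ j %[mod n] -> x = y %[mod n].
Proof. by rewrite ![_ * 2 ^ j]mulnC => /coprime_modMl; apply; apply: coprime_2n. Qed.

Lemma dvdn_2Xm x : n %| x * 2 ^ m + x.
Proof. by rewrite nE; apply/dvdnP; exists x; lia. Qed.

Lemma mul2X_period x : x * 2 ^ (2 * m) = x %[mod n].
Proof.
have -> : x * 2 ^ (2 * m) = x + (x * (2 ^ m - 1)) * n.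
  rewrite mulnC [2 * m]mulnC expnM nE; have := expn_gt0 2 m.
  case: (2 ^ m) => // p _; rewrite subn1 /=; ring.
by rewrite -modnDmr modnMl addn0.
Qed.

Lemma mul2X_mod_period x j : x * 2 ^ (j %% (2 * m)) = x * 2 ^ j %[mod n].
Proof.
rewrite {2}(divn_eq j (2 * m)) expnD mulnA; set r := 2 ^ (_ %% _).
elim: (j %/ _) => [|k IH]; first by rewrite mul0n muln1.
rewrite IH mulSn expnD mulnA -[X in _ = X %[mod _]]mulnA -[RHS]modnMml.
by rewrite mul2X_period modnMml mulnA.
Qed.

Lemma same_coset_refl x : same_coset n x x.
Proof. by exists 0; rewrite muln1. Qed.

Lemma same_coset_trans y x z : same_coset n x y -> same_coset n y z -> same_coset n x z.
Proof.
by move=> [j yE] [k zE]; exists (j + k); rewrite zE -modnMml yE modnMml expnD mulnA.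
Qed.

Lemma same_coset_lt x y : same_coset n x y ->
  exists2 j, j < 2 * m & y = x * 2 ^ j %[mod n].
Proof.
move=> [j yE]; exists (j %% (2 * m)); first by rewrite ltn_pmod; lia.
by rewrite mul2X_mod_period.
Qed.

Lemma same_coset_sym x y : same_coset n x y -> same_coset n y x.
Proof.
move=> /same_coset_lt[j ltj yE]; exists (2 * m - j).
by rewrite -modnMml yE modnMml -mulnA -expnD subnKC ?mul2X_period // ltnW.
Qed.

(** A minus sign is the factor 2^m, so cosets are closed under negation. *)
Lemma eq_mod_opp_coset x j y : eq_mod_opp n (x * 2 ^ j) y -> same_coset n x y.
Proof.
case=> [yE|dy]; first by exists j.
exists (j + m); apply/eqP; rewrite -(eqn_modDl (x * 2 ^ j)).
move: (dvdn_2Xm (x * 2 ^ j)); rewrite -mulnA -expnD addnC.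
by rewrite /dvdn => /eqP ->; apply: dy.
Qed.

(** Multiplying by 2^(m - e) completes 2^e to 2^m = -1. Exchanging the two numbers in this way
    halves the range of exponents to examine. *)
Lemma eq_mod_opp_flip x y e : e <= m ->
  eq_mod_opp n (x * 2 ^ e) y -> eq_mod_opp n (y * 2 ^ (m - e)) x.
Proof.
move=> em [yE|dy]; [right|left].
  rewrite /dvdn -modnDml -modnMml -yE modnMml -mulnA -expnD subnKC // modnDml.
  exact: dvdn_2Xm.
apply/eqP; rewrite -(eqn_modDl (x * 2 ^ m)).
rewrite (eqP (dvdn_2Xm x)) -{1}(subnKC em) expnD mulnA -mulnDl.
exact: dvdn_mulr.
Qed.

Lemma eq_mod_opp_small x y : 2 * x < n -> 2 * y < n -> eq_mod_opp n x y -> x = y.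
Proof.
move=> hx hy [|]; first by rewrite !modn_small //; lia.
case: (posnP (x + y)) => [|h]; first lia.
by move/(dvdn_leq h); lia.
Qed.

(* The powers [2^m = -1] and [2^(2m) = 1] reduce any coincidence to an exponent below [m]. *)
Lemma coset_collision x y d : 0 < x -> 2 * x < n -> 2 * y < n -> d < 2 * m ->
  y = x * 2 ^ d %[mod n] ->
  (d = 0 /\ x = y) \/ exists2 e, 0 < e < m & eq_mod_opp n (x * 2 ^ e) y.
Proof.
move=> x0 hx hy hd yE.
have [d0|d0] := posnP d.
  by left; split=> //; apply: eq_mod_opp_small => //; left; rewrite yE d0 muln1.
right; have [dm|md] := ltnP d m; first by exists d; rewrite ?d0 //; left.
have yE' : eq_mod_opp n (x * 2 ^ (d - m)) y.
  right; rewrite /dvdn -modnDmr yE modnDmr -{2}(subnK md) expnD mulnA addnC.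
  exact: dvdn_2Xm.
exists (d - m) => //; apply/andP; split; last lia.
rewrite lt0n; apply/eqP => dm0; move: yE'; rewrite dm0 muln1 => E.
have xy := eq_mod_opp_small hx hy E.
have dE : d = m by lia.
move: (dvdn_2Xm x); rewrite /dvdn -modnDml -dE -yE modnDml -xy.
by move/eqP/eqP => /dvdn_leq; lia.
Qed.

(** Ensures that the elements of [L] have pairwise disjoint cosets of full size 2m; full size comes
    from the case x = y. *)
Definition coset_free (L : seq nat) :=
  [/\ uniq L, {in L, forall x, 0 < x /\ 2 * x < n} &
   {in L &, forall x y e, 0 < e < m -> ~ eq_mod_opp n (x * 2 ^ e) y}].

Definition coset_seq (L : seq nat) := [seq (x * 2 ^ j) %% n | x <- L, j <- iota 0 (2 * m)].

Lemma size_coset_seq L : size (coset_seq L) = 2 * m * size L.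
Proof. by rewrite size_allpairs size_iota mulnC. Qed.

Lemma uniq_coset_seq L : coset_free L -> uniq (coset_seq L).
Proof.
move=> [uL bL fL]; apply: allpairs_uniq; rewrite ?iota_uniq // => -[x j] [y k].
case/allpairsP=> -[x' j'] /= [xL jI [-> ->]]; case/allpairsP=> -[y' k'] /= [yL kI [-> ->]].
move: x' j' y' k' xL jI yL kI => {}x {}j {}y {}k.
rewrite !mem_iota !add0n /= => xL jI yL kI.
wlog kj : x y j k xL yL jI kI / k <= j.
  by move=> H; case/orP: (leq_total k j) => ? /esym E; [|symmetry]; apply: H.
move=> E; have [x0 hx] := bL x xL; have [y0 hy] := bL y yL.
have : y = x * 2 ^ (j - k) %[mod n].
  by apply: (@mul2X_inj k); rewrite -mulnA -expnD subnK.
case/(coset_collision x0 hx hy (leq_ltn_trans (leq_subr _ _) jI)) => [[d0 ->]|[e he ee]].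
  by congr pair; lia.
by case: (fL x y xL yL e he).
Qed.

Lemma mem_coset_seq L i : i < n ->
  reflect (exists2 x, x \in L & same_coset n x i) (i \in coset_seq L).
Proof.
move=> ltin; apply: (iffP allpairsP) => [[[x j] /= [xL _ iE]]|[x xL /same_coset_lt[j hj iE]]].
  by exists x => //; exists j; rewrite iE modn_mod.
by exists (x, j); rewrite mem_iota /=; split=> //; rewrite -iE modn_small.
Qed.

Lemma coset_seq_lt L : {in coset_seq L, forall i, i < n}.
Proof. by move=> i /allpairsP[[x j] /= [_ _ ->]]; rewrite ltn_pmod // nE addn1. Qed.

Lemma mem_cyc_coset x (i : 'I_n) : reflect (same_coset n x i) (i \in cyc_coset n x).
Proof.
rewrite inE; apply: (iffP existsP) => [[j /eqP iE]|/same_coset_lt[j hj iE]].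
  by exists j; rewrite iE modn_mod.
(* The exponent in [cyc_coset] runs below [n], which covers a whole period since [2 * m <= n]. *)
have jn : j < n.
  by apply: leq_trans hj _; rewrite nE; case: (m) m_gt0 => // k _; have := ltn_expl k (ltnSn 1);
     rewrite expnS; lia.
by exists (Ordinal jn); rewrite /= -iE modn_small.
Qed.

Lemma mem_defset1 delta (i : 'I_n) :
  reflect (exists2 x, 0 < x < delta & same_coset n x i) (i \in bch_defset n 1 delta).
Proof.
apply: (iffP bigcupP) => [[x _ /mem_cyc_coset xi]|[x xd xi]].
  by exists (1 + x) => //; have := ltn_ord x; lia.
have xd' : x.-1 < delta.-1 by lia.
exists (Ordinal xd') => //=; apply/mem_cyc_coset.
by rewrite add1n prednK //; case/andP: xd.
Qed.

Lemma same_coset0 (i : nat) : i < n -> (same_coset n 0 i <-> i = 0).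
Proof.
move=> ltin; split=> [[j]|->]; last exact: same_coset_refl.
by rewrite mul0n mod0n modn_small.
Qed.

Lemma mem_defset0 delta (i : 'I_n) : 0 < delta ->
  (i \in bch_defset n 0 delta.+1) = ((i : nat) == 0) || (i \in bch_defset n 1 delta).
Proof.
move=> d0; apply/bigcupP/orP => [[x _ /mem_cyc_coset xi]|].
  have [x0|x0] := posnP x.
    by left; apply/eqP; apply/same_coset0 => //; rewrite -[X in same_coset n X _]x0.
  by right; apply/mem_defset1; exists x => //; rewrite x0 /=; have := ltn_ord x.
case=> [/eqP i0|/mem_defset1[x /andP[_ xd] xi]].
  exists (Ordinal d0) => //=; apply/mem_cyc_coset/same_coset0 => //.
by exists (Ordinal xd) => //=; apply/mem_cyc_coset.
Qed.

Lemma defset1_neq0 delta (i : 'I_n) : delta <= n ->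
  i \in bch_defset n 1 delta -> 0 < i.
Proof.
move=> dn /mem_defset1[x xd /same_coset_sym xi]; rewrite lt0n; apply/eqP=> i0.
by move: xi; rewrite i0 => /same_coset0; lia.
Qed.

Lemma card_defset0 delta : 0 < delta <= n ->
  #|bch_defset n 0 delta.+1| = #|bch_defset n 1 delta|.+1.
Proof.
move=> /andP[d0 dn]; have n0 : 0 < n by lia.
rewrite (cardsD1 (Ordinal n0)) mem_defset0 //= add1n; congr _.+1.
apply: eq_card => i; rewrite !inE mem_defset0 // -val_eqE /=.
case: posnP => //= i0; case: (boolP (i \in _)) => // /(defset1_neq0 dn).
by rewrite i0.
Qed.

Lemma defset1_double delta (i j : 'I_n) :
  i \in bch_defset n 1 delta -> (j : nat) = (2 * i) %% n -> j \in bch_defset n 1 delta.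
Proof.
move=> /mem_defset1[x xd xi] jE; apply/mem_defset1; exists x => //.
apply: same_coset_trans xi _; exists 1; by rewrite jE modn_mod mulnC.
Qed.

Lemma defset0_double delta (i j : 'I_n) : 0 < delta ->
  i \in bch_defset n 0 delta.+1 -> (j : nat) = (2 * i) %% n -> j \in bch_defset n 0 delta.+1.
Proof.
move=> d0; rewrite !mem_defset0 // => /orP[/eqP -> ->|iD jE]; first by rewrite muln0 mod0n.
by rewrite (defset1_double iD jE) orbT.
Qed.

End Cosets.

(** * Small designed distances *)

Lemma size_odd_without d (N : seq nat) : uniq N -> {in N, forall x, odd x && (x < d)} ->
  size [seq x <- iota 0 d | odd x && (x \notin N)] + size N = d./2.
Proof.
move=> uN oN; rewrite -size_cat.
have <- : size [seq x <- iota 0 d | odd x] = d./2.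
  by elim: d {oN} => // d IH; rewrite -addn1 iotaD filter_cat size_cat IH /= add0n; case: ifP => /=; lia.
apply: perm_size; apply: uniq_perm; rewrite ?filter_uniq ?iota_uniq //.
  rewrite cat_uniq filter_uniq ?iota_uniq //= uN andbT; apply/hasPn=> x xN.
  by rewrite mem_filter xN andbF.
move=> x; rewrite mem_cat !mem_filter mem_iota /= add0n.
case: (boolP (x \in N)) => [/oN -> | _]; last by rewrite orbF andbT.
by rewrite orbT.
Qed.

Section SmallArithmetic.
Variables H n x y : nat.
Hypotheses (H_ge16 : 16 <= H) (nE : n = 8 * (H * H) + 1).
Hypotheses (xB : x + 9 <= 8 * H) (yB : y + 9 <= 8 * H).

(** Used with H = 2^(t - 1) and p = 2^j, j <= t - 2: the product is at most 4 H^2, about n / 2, and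
    [x] is too small to fill the gap. *)
Lemma no_small_quotient p : 2 * p <= H -> ~ (y * p = n + x \/ y * p + x = n).
Proof.
move=> pH; have : (y + 9) * (2 * p) <= 8 * H * H by apply: leq_mul.
have : 16 * H <= H * H by rewrite leq_mul2r H_ge16 orbT.
lia.
Qed.

(** The margin 9 is decisive: [y * H + x] is at most 8 H^2 - H - 9, just short of [n]. *)
Lemma no_small_multiple : ~ (y * H = n + x \/ y * H + x = n).
Proof.
have : (y + 9) * H <= 8 * H * H by rewrite leq_mul2r yB orbT.
lia.
Qed.

(** As [x < 8 * H], the odd number [y] is within 4 of 4 H. The values 4 H +- 1 are listed, and y = 4
    H +- 3 forces x = 6 H -+ 1. *)
Lemma double_multiple : odd y -> y * (2 * H) = n + x \/ y * (2 * H) + x = n ->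
  [|| x == 4 * H - 1, x == 4 * H + 1, x == 4 * H + 2 * H - 1 | x == 4 * H + 2 * H + 1]
  || [|| y == 4 * H - 1, y == 4 * H + 1, y == 4 * H + 2 * H - 1 | y == 4 * H + 2 * H + 1].
Proof.
move=> oy E.
have [h1|h1] := leqP (4 * H + 5) y.
  have : (4 * H + 5) * (2 * H) <= y * (2 * H) by rewrite leq_mul2r h1 orbT.
  lia.
have [h2|h2] := leqP (y + 5) (4 * H).
  have : (y + 5) * (2 * H) <= 4 * H * (2 * H) by rewrite leq_mul2r h2 orbT.
  lia.
have [u uE] : exists u, y + 4 = 4 * H + u by exists (y + 4 - 4 * H); lia.
have uH : (y + 4) * (2 * H) = (4 * H + u) * (2 * H) by rewrite uE.
have u8 : u <= 8 by lia.
have ou : odd u by lia.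
by move: u8 ou; do 9?[case: u uE uH => [|u] uE uH] => // _ _; lia.
Qed.

End SmallArithmetic.

Section SmallLeaders.
Variables t m n : nat.
Hypotheses (t_ge5 : 5 <= t) (mE : m = 2 * t + 1) (nE : n = 2 ^ m + 1).

Let m_gt0 : 0 < m. Proof. by rewrite mE addn1. Qed.

(** The only odd numbers below 2^(t+2) - 7 whose coset contains a smaller positive number. *)
Definition nonleaders :=
  [:: 2 ^ t.+1 - 1; 2 ^ t.+1 + 1; 2 ^ t.+1 + 2 ^ t - 1; 2 ^ t.+1 + 2 ^ t + 1].

Variable H : nat.
Hypothesis HE : H = 2 ^ (t - 1).
Let H_ge16 : 16 <= H. Proof. by rewrite HE; apply: (@leq_pexp2l 2 4); lia. Qed.
Let pow_t : 2 ^ t = 2 * H. Proof. by rewrite HE -expnS; congr (_ ^ _); lia. Qed.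
Let pow_t1 : 2 ^ t.+1 = 4 * H. Proof. by rewrite expnS pow_t; lia. Qed.
Let pow_t2 : 2 ^ t.+2 = 8 * H. Proof. by rewrite expnS pow_t1; lia. Qed.
Let nEH : n = 8 * (H * H) + 1.
Proof. by rewrite nE mE mul2n -addnn expnD expnD pow_t expn1; lia. Qed.
Let n_big : 128 * H < n.
Proof. by rewrite nEH; have : 16 * H <= H * H by [rewrite leq_mul2r H_ge16 orbT]; lia. Qed.

Lemma eq_mod_opp_small_exp j x y : 1 <= j <= t -> odd x -> odd y ->
    x <= 2 ^ t.+2 - 9 -> y <= 2 ^ t.+2 - 9 -> eq_mod_opp n (y * 2 ^ j) x ->
  x \in nonleaders \/ y \in nonleaders.
Proof.
rewrite pow_t2 => /andP[j1 jt] ox oy xB yB E.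
have {}xB : x + 9 <= 8 * H by lia.
have {}yB : y + 9 <= 8 * H by lia.
have pj_le : 2 ^ j <= 2 * H by rewrite -pow_t leq_pexp2l.
have pj_ge : 2 <= 2 ^ j by apply: (@leq_pexp2l 2 1).
have yj_even : ~~ odd (y * 2 ^ j) by rewrite oddM oddX; case: (j) j1 => // ?; rewrite andbF.
have yj_lt : (y + 9) * 2 ^ j <= 8 * H * (2 * H) by apply: leq_mul.
(* The product is even and below 2 n while [x] is odd, so exactly one copy of [n] can be
   involved. *)
have {E} E : y * 2 ^ j = n + x \/ y * 2 ^ j + x = n.
  have yj_lt2 : (y + 9) * (2 * H) <= 8 * H * (2 * H) by rewrite leq_mul2r yB orbT.
  have yj_lt3 : y * 2 ^ j <= y * (2 * H) by rewrite leq_mul2l pj_le orbT.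
  case: E => [E|/dvdnP[k kE]].
    left; have xn : x %% n = x by rewrite modn_small //; lia.
    move: (divn_eq (y * 2 ^ j) n); rewrite E xn; case: (_ %/ n) => [|[|k]] kE.
    - by rewrite kE mul0n add0n ox in yj_even.
    - lia.
    - by have : 2 * n <= k.+2 * n by [rewrite leq_mul2r orbT]; lia.
  right; case: k kE => [|[|k]] kE.
  - by move: ox; have -> : x = 0 by lia.
  - lia.
  - by have : 2 * n <= k.+2 * n by [rewrite leq_mul2r orbT]; lia.
have [jt2|jt2] := leqP j (t - 2).
  have pj : 2 * 2 ^ j <= H by rewrite HE -expnS leq_pexp2l; lia.
  by case: (no_small_quotient H_ge16 nEH xB yB pj E).
have [jE|jE] : j = t - 1 \/ j = t by lia.
  by move: E; rewrite jE -HE => /no_small_multiple; case.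
move: E; rewrite jE pow_t => E.
rewrite /nonleaders pow_t1 pow_t !inE.
by apply/orP; apply: double_multiple E.
Qed.

Definition small_leaders d := [seq x <- iota 0 d | odd x && (x \notin nonleaders)].

Lemma mem_small_leaders d x :
  (x \in small_leaders d) = [&& odd x, x \notin nonleaders & x < d].
Proof. by rewrite mem_filter mem_iota /= andbA. Qed.

Lemma small_leaders_free d : d <= 2 ^ t.+2 - 7 -> coset_free m n (small_leaders d).
Proof.
rewrite pow_t2 => dB; split; first by rewrite filter_uniq ?iota_uniq.
  by move=> x; rewrite mem_small_leaders => /and3P[ox _ xd]; split; last lia; case: (x) ox => [|?].
move=> x y; rewrite !mem_small_leaders => /and3P[ox xN xd] /and3P[oy yN yd] e /andP[e0 em] E.
have xB : x <= 2 ^ t.+2 - 9 by lia.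
have yB : y <= 2 ^ t.+2 - 9 by lia.
have [et|te] := leqP e t.
  have e1t : 1 <= e <= t by rewrite e0.
  by case: (eq_mod_opp_small_exp e1t oy ox yB xB E) => N; rewrite N in xN yN.
(* Since m = 2 t + 1, an exponent above t flips to one at most t. *)
have {}E := eq_mod_opp_flip m_gt0 nE (ltnW em) E.
have e1t : 1 <= m - e <= t by lia.
by case: (eq_mod_opp_small_exp e1t ox oy xB yB E) => N; rewrite N in xN yN.
Qed.

(** Strong induction: a [z] outside the list is sent, up to sign, to a smaller number by a power of
    2. The window around 2^(t+2) brings no new coset, which is what raises the distance bound there
    to 2^(t+2) + 9. *)
Lemma small_leaders_cover d z : 0 < z -> z < d \/ (d = 2 ^ t.+2 - 7 /\ z < 2 ^ t.+2 + 9) ->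
  exists2 l, l \in small_leaders d & same_coset n l z.
Proof.
elim/ltn_ind: z => z IH z0 zd.
have step y j : 0 < y < z -> eq_mod_opp n (z * 2 ^ j) y ->
    exists2 l, l \in small_leaders d & same_coset n l z.
  move=> /andP[y0 yz] /(eq_mod_opp_coset m_gt0 nE)/(same_coset_sym m_gt0 nE) yz'.
  have [|l lL ly] := IH y yz y0; first lia.
  by exists l => //; apply: same_coset_trans ly yz'.
have [oz|ez] := boolP (odd z); last first.
  apply: (step z./2 (2 * m - 1)); first lia.
  left; rewrite -{1}[z]even_halfK // -muln2 -mulnA -expnS.
  by rewrite (_ : (2 * m - 1).+1 = 2 * m) ?(mul2X_period nE) //; lia.
have [zN|zN] := boolP (z \in nonleaders).
  (* With n = 8 H^2 + 1, (4 H -+ 1) 2 H = n -+ (2 H +- 1). For 6 H -+ 1 the relation is used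
     backwards: (4 H +- 3) 2 H = n +- (6 H -+ 1). *)
  move: zN; rewrite !inE pow_t1 pow_t => /or4P[]/eqP zE.
  - apply: (step (2 * H + 1) t); first lia.
    have : (z + 1) * (2 * H) = 4 * H * (2 * H) by congr (_ * _); lia.
    by right; rewrite pow_t (_ : _ + _ = n) ?dvdnn //; lia.
  - apply: (step (2 * H - 1) t); first lia.
    have : z * (2 * H) = (4 * H + 1) * (2 * H) by rewrite zE.
    by left; rewrite pow_t (_ : _ * _ = 2 * H - 1 + n) ?modnDr //; lia.
  - apply: (step (4 * H + 3) (m - t)); first lia.
    apply: (eq_mod_opp_flip m_gt0 nE); first lia.
    by left; rewrite pow_t (_ : _ * _ = z + n) ?modnDr //; lia.
  - apply: (step (4 * H - 3) (m - t)); first lia.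
    apply: (eq_mod_opp_flip m_gt0 nE); first lia.
    have : (4 * H - 3 + 3) * (2 * H) = 4 * H * (2 * H) by congr (_ * _); lia.
    rewrite mulnDl => yH; right; rewrite pow_t (_ : _ + _ = n) ?dvdnn //; lia.
have [ltz|lez] := ltnP z d.
  by exists z; [rewrite mem_small_leaders oz zN | apply: same_coset_refl].
move: zd; rewrite pow_t2 => -[|[dE zB]]; first lia.
have {}lez : 8 * H - 7 <= z by rewrite -dE.
(* Writing z = 8 H -+ u gives z H = n -+ (u H +- 1). Oddness of [z] leaves u <= 7, so the residue is
   smaller than [z]. *)
have [lt8|le8] := ltnP z (8 * H).
  have [u [uE u8]] : exists u, z + u = 8 * H /\ u <= 7 by exists (8 * H - z); lia.
  have uH : H * u <= H * 7 by rewrite leq_mul2l u8 orbT.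
  apply: (step (H * u + 1) (t - 1)); first lia.
  have : (z + u) * H = 8 * H * H by rewrite uE.
  by right; rewrite -HE (_ : _ + _ = n) ?dvdnn //; lia.
have [u [uE u0 u8]] : exists u, [/\ z = 8 * H + u, 0 < u & u <= 7].
  by exists (z - 8 * H); split; lia.
have uH : H * u <= H * 7 by rewrite leq_mul2l u8 orbT.
have uH1 : H * 1 <= H * u by rewrite leq_mul2l u0 orbT.
apply: (step (H * u - 1) (t - 1)); first lia.
have : z * H = (8 * H + u) * H by rewrite uE.
left; rewrite -HE (_ : z * H = H * u - 1 + n) ?modnDr //; lia.
Qed.

(** Only two nonleaders lie below [d], among its (d - 1) / 2 odd predecessors: 5 = 2 * 2 + 1. *)
Lemma size_small_leaders1 d : odd d -> 2 ^ t.+1 + 3 <= d <= 2 ^ t.+1 + 2 ^ t - 3 ->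
  2 * size (small_leaders d) + 5 = d.
Proof.
rewrite pow_t1 pow_t => od hd.
have -> : small_leaders d =
    [seq x <- iota 0 d | odd x && (x \notin [:: 2 ^ t.+1 - 1; 2 ^ t.+1 + 1])].
  apply: eq_in_filter => x; rewrite mem_iota /= => hx; rewrite !inE pow_t1 pow_t.
  by congr (_ && _); lia.
rewrite pow_t1.
have uN : uniq [:: 4 * H - 1; 4 * H + 1] by rewrite /= inE; lia.
have oN : {in [:: 4 * H - 1; 4 * H + 1], forall x, odd x && (x < d)}.
  by move=> x; rewrite !inE => /orP[]/eqP ->; lia.
by have /= := size_odd_without uN oN; lia.
Qed.

(** All four nonleaders lie below [d]: 9 = 2 * 4 + 1. *)
Lemma size_small_leaders2 d : odd d -> 2 ^ t.+1 + 2 ^ t + 3 <= d ->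
  2 * size (small_leaders d) + 9 = d.
Proof.
rewrite pow_t1 pow_t => od hd.
have uN : uniq nonleaders by rewrite /nonleaders pow_t1 pow_t /= !inE; lia.
have oN : {in nonleaders, forall x, odd x && (x < d)}.
  by move=> x; rewrite !inE pow_t1 pow_t => /or4P[]/eqP ->; lia.
by have := size_odd_without uN oN; rewrite -/(small_leaders d) /=; lia.
Qed.

(** [d0] is where the list of leaders stops: at [d] itself, or frozen at 2^(t+2) - 7 throughout the
    window. *)
Lemma card_defset_small d d0 : d0 <= 2 ^ t.+2 - 7 -> d0 <= d ->
  d = d0 \/ (d0 = 2 ^ t.+2 - 7 /\ d <= 2 ^ t.+2 + 9) ->
  #|bch_defset n 1 d| = 2 * m * size (small_leaders d0).
Proof.
move=> d0B dd0 hd.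
have Lfree := small_leaders_free d0B.
rewrite -(size_coset_seq m n); apply: card_nat_seq.
- exact: uniq_coset_seq m_gt0 nE _ Lfree.
- exact: (coset_seq_lt nE).
move=> i; apply/(mem_defset1 m_gt0 nE)/(mem_coset_seq m_gt0 nE) => //.
  move=> [x /andP[x0 xd] xi].
  have [|l lL lx] := @small_leaders_cover d0 x x0; first lia.
  by exists l => //; apply: same_coset_trans lx xi.
move=> [x]; rewrite mem_small_leaders => /and3P[ox _ xd] xi.
by exists x => //; move: ox; case: (posnP x) => [->//|] *; lia.
Qed.

End SmallLeaders.

(** * Large designed distances *)

Lemma pow2_mod3 k : exists q, 2 ^ k = 3 * q + 1 + odd k.
Proof.
elim: k => [|k [q IH]]; first by exists 0.
by rewrite expnS IH /=; case: (odd k); [exists (2 * q + 1) | exists (2 * q)]; lia.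
Qed.

Lemma eq_mod_opp_double n a b : eq_mod_opp n a b -> eq_mod_opp n (a * 2) (2 * b).
Proof.
case=> [ab|dab]; [left|right]; first by rewrite -modnMml ab modnMml mulnC.
by rewrite [2 * b]mulnC -mulnDl dvdn_mulr.
Qed.

Lemma eq_mod_opp_compl n a b : b <= n -> eq_mod_opp n a b -> eq_mod_opp n a (n - b).
Proof.
move=> bn [ab|dab]; [right|left].
  by rewrite /dvdn -modnDml ab modnDml subnKC // modnn.
apply/eqP; rewrite -(eqn_modDr b) subnK // modnn.
by apply: dab.
Qed.

(* Here [l = (n - s) / 6] and [E = 3 q + rho], so that [2 l E = (rho n - s E) / 3] modulo [n];
   [o] shifts this residue into [0, n). *)
Lemma residue_above_sixth n l s E q rho o :
    6 * l + s = n -> E = 3 * q + rho -> o <= q ->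
    n + 2 * (s * E) < 2 * ((rho + 3 * o) * n) < 5 * n + 2 * (s * E) ->
  exists k r, l * (2 * E) = k * n + r /\ n < 6 * r < 5 * n.
Proof.
move=> ls Eq oq bounds; exists (q - o), (l * (2 * E) - (q - o) * n).
have nE1 : (6 * l + s) * E = n * (3 * q + rho) by rewrite ls Eq.
have qo : (q - o) * n + o * n = q * n by rewrite -mulnDl subnK.
move: nE1 qo bounds; set Q := (q - o) * n; rewrite !mulnDl mulnDr.
rewrite (_ : l * (2 * E) = 2 * (l * E)); last by rewrite mulnCA.
lia.
Qed.

Section LargeLeaders.
Variables m n w : nat.
Hypotheses (m_odd : odd m) (m_ge11 : 11 <= m) (nE : n = 2 ^ m + 1) (wE : n = 6 * w + 3).

Let m_gt0 : 0 < m. Proof. exact: leq_trans m_ge11. Qed.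

Lemma n_large : 2048 < n.
Proof. by rewrite nE addn1 ltnS; apply: (@leq_pexp2l 2 11). Qed.

(** Doubling modulo sign, on representatives below n / 2. *)
Definition fold_double a := if 4 * a < n then 2 * a else n - 2 * a.

Lemma fold_double_bounds a : 0 < a -> 2 * a < n ->
  0 < fold_double a /\ 2 * fold_double a < n.
Proof. by rewrite /fold_double; case: (ltnP (4 * a) n); lia. Qed.

Lemma iter_fold_double a j : 0 < a -> 2 * a < n ->
  [/\ 0 < iter j fold_double a, 2 * iter j fold_double a < n &
      eq_mod_opp n (a * 2 ^ j) (iter j fold_double a)].
Proof.
move=> a0 an; elim: j => [|j [b0 bn E]]; first by split=> //; left; rewrite muln1.
have [c0 cn] := fold_double_bounds b0 bn; rewrite iterS; split=> //.
have {}E := eq_mod_opp_double E; rewrite expnS mulnCA mulnC /fold_double.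
by case: ifP => // _; apply: eq_mod_opp_compl => //; exact: ltnW bn.
Qed.

Lemma iter_fold_double_period a : 0 < a -> 2 * a < n -> iter m fold_double a = a.
Proof.
move=> a0 an; have [b0 bn /(eq_mod_opp_flip m_gt0 nE (leqnn m))] := iter_fold_double m a0 an.
by rewrite subnn muln1 => /(eq_mod_opp_small m_gt0 nE); apply.
Qed.

(* Above [n / 6] the folded doubling map swaps the two sides of [n / 3], which contradicts
   an odd period unless the orbit is the fixed point [n / 3]. *)
Lemma orbit_above_sixth a : 0 < a -> 2 * a < n ->
  (forall j, j <= m -> n < 6 * iter j fold_double a) -> 3 * a = n.
Proof.
move=> a0 an above; apply/eqP/contraT => /eqP a3.
have side j : j <= m -> 3 * iter j fold_double a <> n /\
    (3 * iter j fold_double a < n) = (odd j (+) (3 * a < n)).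
  elim: j => [//|j IH] jm; have [b3 IHs] := IH (ltnW jm).
  have := above _ (ltnW jm); have := above _ jm.
  have [b0 bn _] := iter_fold_double j a0 an.
  rewrite iterS /= addNb -IHs; move: b3 b0 bn; set b := iter j _ a.
  by rewrite /fold_double; case: (ltnP (4 * b) n); lia.
have [_] := side m (leqnn m); rewrite iter_fold_double_period // m_odd.
by case: (3 * a < n).
Qed.

Lemma near_sixth_nonleader a i : a + i = w -> i \in [:: 1; 3; 4; 5; 6; 7] ->
  exists2 y, 0 < y < w - 8 & same_coset n y a.
Proof.
move=> aw hi.
suff [c [j [c0 cw /(eq_mod_opp_coset m_gt0 nE)/(same_coset_sym m_gt0 nE) ca]]] :
    exists c j, [/\ 0 < c, c < w - 8 & eq_mod_opp n (a * 2 ^ j) c].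
  by exists c; rewrite ?c0.
have nbig := n_large.
have [i1|i1] := eqVneq i 1.
  (* With 2^(m-3) = 3 q + 1 one has n = 24 q + 9 and a = 4 q, so a 2^(m-2) = q n - q. *)
  have [q qE] := pow2_mod3 (m - 3).
  have pm : 2 ^ m = 8 * 2 ^ (m - 3) by rewrite -(expnD 2 3); congr (_ ^ _); lia.
  have {}qE : 2 ^ (m - 3) = 3 * q + 1 by rewrite qE; lia.
  exists q, (m - 3).+1; split; [lia | lia | right].
  apply/dvdnP; exists q; rewrite expnS nE pm qE (_ : a = 4 * q); last lia.
  ring.
(* With 2^(m-5) = 3 q + 1 one has n = 96 q + 33 and a = 16 q + 5 - i; multiplying by 2^(m-4) = 6 q +
   2 leaves, up to sign, a residue linear in q. *)
have [q qE] := pow2_mod3 (m - 5).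
have pm : 2 ^ m = 32 * 2 ^ (m - 5) by rewrite -(expnD 2 5); congr (_ ^ _); lia.
have {}qE : 2 ^ (m - 5) = 3 * q + 1 by rewrite qE; lia.
have nq : n = 96 * q + 33 by lia.
have residue_pos c : a * (2 * (3 * q + 1)) = c + q * n -> 0 < c < w - 8 ->
    exists c j, [/\ 0 < c, c < w - 8 & eq_mod_opp n (a * 2 ^ j) c].
  move=> cE /andP[c0 cw]; exists c, (m - 5).+1; split=> //; left.
  by rewrite expnS qE cE -modnDmr modnMl addn0.
have residue_neg c : a * (2 * (3 * q + 1)) + c = q * n -> 0 < c < w - 8 ->
    exists c j, [/\ 0 < c, c < w - 8 & eq_mod_opp n (a * 2 ^ j) c].
  move=> cE /andP[c0 cw]; exists c, (m - 5).+1; split=> //; right.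
  by rewrite expnS qE cE dvdn_mull.
move: hi; rewrite !inE (negPf i1) /= => /or4P[/eqP iE|/eqP iE|/eqP iE|/orP[]/eqP iE].
- apply: (residue_pos (11 * q + 4)); last lia.
  by rewrite nq (_ : a = 16 * q + 2); [ring | lia].
- apply: (residue_pos (5 * q + 2)); last lia.
  by rewrite nq (_ : a = 16 * q + 1); [ring | lia].
- apply: (residue_neg q); last lia.
  by rewrite nq (_ : a = 16 * q); [ring | lia].
- apply: (residue_neg (7 * q + 2)); last lia.
  have : (a + 1) * (6 * q + 2) = 16 * q * (6 * q + 2) by congr (_ * _); lia.
  by rewrite nq; lia.
- apply: (residue_neg (13 * q + 4)); last lia.
  have : (a + 2) * (6 * q + 2) = 16 * q * (6 * q + 2) by congr (_ * _); lia.
  by rewrite nq; lia.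
Qed.

Definition large_leaders := [:: w; w - 2; w - 8].

Lemma large_leaders_cover a : 0 < a -> 2 * a < n ->
  (exists2 y, 0 < y < w - 8 & same_coset n y a) \/
  (exists2 l, l \in 2 * w + 1 :: large_leaders & same_coset n l a).
Proof.
elim/ltn_ind: a => a IH a0 an.
have [aw|wa] := ltnP a (w - 8).
  by left; exists a; rewrite ?a0 //; apply: same_coset_refl.
(* Either the folded orbit descends and induction applies, or [a] is minimal in it. *)
have [/existsP[j lt_ja]|min_a] := boolP [exists j : 'I_m.+1, iter j fold_double a < a].
  have [b0 bn /(eq_mod_opp_coset m_gt0 nE)/(same_coset_sym m_gt0 nE) ba] :=
    iter_fold_double j a0 an.
  case: (IH _ lt_ja b0 bn) => [] [y hy yb]; [left|right]; exists y => //;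
    exact: same_coset_trans yb ba.
have {}min_a j : j <= m -> a <= iter j fold_double a.
  rewrite -ltnS => jm; move: min_a; rewrite negb_exists => /forallP/(_ (Ordinal jm)).
  by rewrite -leqNgt.
have [lt6a|le6a] := ltnP n (6 * a).
  right; exists (2 * w + 1); first by rewrite mem_head.
  have a3 : 3 * a = n by apply: orbit_above_sixth => // j /min_a; lia.
  by rewrite (_ : 2 * w + 1 = a); [apply: same_coset_refl | lia].
(* Now w - 8 <= a <= w, and the offsets other than 0, 2, 8 are nonleaders. *)
have [i iE] : exists i, a + i = w by exists (w - a); lia.
have [hi|hi] := boolP (i \in [:: 1; 3; 4; 5; 6; 7]).
  by left; apply: near_sixth_nonleader hi.
right; exists a; last exact: same_coset_refl.
move: hi; rewrite !inE; lia.
Qed.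

(** The residue stays farther than n / 6 from every multiple of [n], so no number below n / 6 is
    met, even up to sign. *)
Lemma large_leaders_orbit l j : l \in large_leaders -> 0 < j < m ->
  exists k r, l * 2 ^ j = k * n + r /\ n < 6 * r < 5 * n.
Proof.
move=> hl /andP[j0 jm]; rewrite -(prednK j0) expnS.
move: j.-1 (leq_ltn_trans (eq_leq (prednK j0)) jm) => {j0 jm}j jm.
have nbig := n_large.
have [s ls hs] : exists2 s, 6 * l + s = n & s \in [:: 3; 15; 51].
  by move: hl; rewrite !inE => /or3P[]/eqP ->; [exists 3 | exists 15 | exists 51] => //; lia.
have [q Eq] := pow2_mod3 j.
have pm i : j + i = m -> n = 2 ^ i * 2 ^ j + 1.
  by move=> ij; rewrite nE -ij expnD mulnC.
have fin o : o <= q ->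
    n + 2 * (s * 2 ^ j) < 2 * ((1 + odd j + 3 * o) * n) < 5 * n + 2 * (s * 2 ^ j) ->
    exists k r, l * (2 * 2 ^ j) = k * n + r /\ n < 6 * r < 5 * n.
  by apply: residue_above_sixth => //; rewrite Eq addnA.
(* If 2^j < n / 256, the term s 2^j with s <= 51 is too small to require a shift; six exponents
   remain. *)
have [far|near] := leqP (j + 8) m.
  have big : 256 * 2 ^ j < n by rewrite nE addn1 ltnS -(expnD 2 8) leq_exp2l // addnC.
  apply: (fin 0); rewrite // muln0 addn0.
  by move: hs; rewrite !inE => /or3P[]/eqP ->; case: (odd j); lia.
have [i iE] : exists i, j + i = m by exists (m - j); lia.
have hi : i \in [:: 2; 3; 4; 5; 6; 7] by rewrite !inE; lia.
have {}pm := pm i iE.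
have oj : odd j = ~~ odd i by move: m_odd; rewrite -iE oddD; case: (odd j); case: (odd i).
rewrite oj in fin Eq.
clear hl jm near oj iE nE.
move: hi hs; rewrite !inE => hi hs.
(* The largest shift used below is 4, and [fin] requires [o <= q]. *)
have q4 : 4 <= q.
  by move: hi => /or4P[/eqP ij|/eqP ij|/eqP ij|/or3P[]/eqP ij]; move: pm Eq; rewrite ij /=; lia.
move: hi hs => /or4P[/eqP ij|/eqP ij|/eqP ij|/or3P[]/eqP ij];
  rewrite ij /= in pm fin => /or3P[]/eqP sE; rewrite sE in fin.
(* Cases run over m - j = 2, .., 7 and, within each, s = 3, 15, 51; the shift offsets the copies of
   [n] absorbed by s 2^j / 3. *)
- by apply: (fin 0); lia.
- by apply: (fin 1); lia.
- by apply: (fin 4); lia.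
- by apply: (fin 0); lia.
- by apply: (fin 1); lia.
- by apply: (fin 2); lia.
- by apply: (fin 0); lia.
- by apply: (fin 0); lia.
- by apply: (fin 1); lia.
- by apply: (fin 0); lia.
- by apply: (fin 0); lia.
- by apply: (fin 1); lia.
- by apply: (fin 0); lia.
- by apply: (fin 0); lia.
- by apply: (fin 0); lia.
- by apply: (fin 0); lia.
- by apply: (fin 0); lia.
- by apply: (fin 0); lia.
Qed.

Lemma large_leaders_isolated l y e : l \in large_leaders -> 0 < y -> 6 * y < n ->
  0 < e < m -> ~ eq_mod_opp n (l * 2 ^ e) y.
Proof.
move=> lL y0 yn he; have [k [r [-> hr]]] := large_leaders_orbit lL he.
have hr' : r %% n = r by rewrite modn_small; lia.
case; first by rewrite modnMDl hr' modn_small; lia.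
rewrite -addnA dvdn_addr ?dvdn_mull // => /dvdn_leq; lia.
Qed.

Lemma large_leaders_free L : uniq L -> {subset L <= large_leaders} -> coset_free m n L.
Proof.
have nbig := n_large.
move=> uL sL; split=> // [x /sL|x y xL yL e he].
  by rewrite !inE => /or3P[]/eqP ->; split; lia.
apply: large_leaders_isolated => //; first exact: sL.
  by move/sL: yL; rewrite !inE => /or3P[]/eqP ->; lia.
by move/sL: yL; rewrite !inE => /or3P[]/eqP ->; lia.
Qed.

Lemma large_leader_min l x : l \in large_leaders -> 0 < x -> same_coset n l x -> l <= x.
Proof.
move=> lL x0 /(same_coset_lt m_gt0 nE)[d hd xE]; rewrite leqNgt; apply/negP=> xl.
have nbig := n_large.
have [l0 ln] : 0 < l /\ 6 * l < n by move: lL; rewrite !inE => /or3P[]/eqP ->; lia.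
case: (coset_collision m_gt0 nE _ _ _ hd xE) => [//|||[_ ?]|[e he]]; try lia.
by apply: large_leaders_isolated => //; lia.
Qed.

(** Here 2 w + 1 = n / 3, so a member of its coset satisfies 3 k = 0 modulo [n]. *)
Lemma same_coset_third k : k < n ->
  same_coset n (2 * w + 1) k <-> (k = 2 * w + 1 \/ k = 4 * w + 2).
Proof.
move=> kn; have n0 : 0 < n by lia.
split=> [k3|[]->]; last 2 first.
- exact: same_coset_refl.
- by exists 1; congr (_ %% _); lia.
have k0 : 0 < k.
  rewrite lt0n; apply/eqP=> kE; rewrite kE in k3.
  by move/(same_coset_sym m_gt0 nE): k3; rewrite same_coset0; lia.
case: k3 => j kE; have /eqP : 3 * k = 0 %[mod n].
  rewrite -modnMmr kE modnMmr mulnA (_ : 3 * (2 * w + 1) = n); last lia.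
  by rewrite modnMr mod0n.
rewrite mod0n => /dvdnP[q qE].
by case: q qE => [|[|[|q]]] qE; lia.
Qed.

Lemma fold_same_coset k : 0 < k < n -> exists a, [/\ 0 < a, 2 * a < n & same_coset n a k].
Proof.
move=> /andP[k0 kn]; have [lek|ltk] := ltnP (2 * k) n.
  by exists k; split=> //; apply: same_coset_refl.
exists (n - k); split; [lia | lia |].
apply: (@eq_mod_opp_coset m n m_gt0 nE _ 0); rewrite muln1; right.
by rewrite subnK // ltnW.
Qed.

(** [Lc] holds the leaders not yet reached by [delta], [Lr] those already reached. *)
Lemma defset1_compl delta Lc Lr : Lc ++ Lr = large_leaders ->
    {in Lc, forall l, delta <= l} -> {in Lr, forall l, l < delta} ->
    w - 8 <= delta <= 2 * w + 1 ->
  forall k : 'I_n, (k \notin bch_defset n 1 delta) =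
    ((k : nat) \in [:: 0, 2 * w + 1, 4 * w + 2 & coset_seq m n Lc]).
Proof.
move=> LE hLc hLr hd k; rewrite !inE.
have sub : {subset Lc <= large_leaders} by move=> l lL; rewrite -LE mem_cat lL.
apply/idP/idP.
  have [//|k0 /=] := posnP k.
  have hk : 0 < k < n by rewrite k0 /=.
  have [a [a0 an ak]] := fold_same_coset hk.
  case: (large_leaders_cover a0 an) => [[y hy ya]|[l lL la]] kD.
    case/negP: kD; apply/(mem_defset1 m_gt0 nE); exists y; first lia.
    exact: same_coset_trans ya ak.
  have lk := same_coset_trans la ak.
  move: lL; rewrite in_cons => /orP[/eqP lE|].
    by move: lk; rewrite lE => /(same_coset_third (ltn_ord k))[]->; rewrite eqxx ?orbT.
  rewrite -LE mem_cat => /orP[lc|lr].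
    by apply/or3P/Or33/(mem_coset_seq m_gt0 nE) => //; exists l.
  case/negP: kD; apply/(mem_defset1 m_gt0 nE); exists l => //.
  rewrite hLr // andbT; have : l \in large_leaders by rewrite -LE mem_cat lr orbT.
  have nbig := n_large.
  by rewrite !inE => /or3P[]/eqP ->; lia.
move=> hk; apply/negP=> /(mem_defset1 m_gt0 nE)[x /andP[x0 xd]].
move=> /(same_coset_sym m_gt0 nE) kx.
have n0 : 0 < n by lia.
case/or4P: hk => [/eqP kE|/eqP kE|/eqP kE|/(mem_coset_seq m_gt0 nE)].
- by move: kx; rewrite kE same_coset0; lia.
- by move: kx; rewrite kE same_coset_third; lia.
- have : same_coset n (2 * w + 1) x.
    by apply: same_coset_trans kx; rewrite kE; exists 1; congr (_ %% _); lia.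
  by rewrite same_coset_third; lia.
move=> /(_ (ltn_ord k))[l lc lk].
have := large_leader_min (sub l lc) x0 (same_coset_trans lk kx).
by have := hLc l lc; lia.
Qed.

Lemma card_defset_large delta Lc Lr : Lc ++ Lr = large_leaders ->
    {in Lc, forall l, delta <= l} -> {in Lr, forall l, l < delta} ->
    w - 8 <= delta <= 2 * w + 1 ->
  #|bch_defset n 1 delta| = n - (2 * m * size Lc + 3).
Proof.
move=> LE hLc hLr hd; have nbig := n_large.
have sub : {subset Lc <= large_leaders} by move=> l lL; rewrite -LE mem_cat lL.
have uL : uniq large_leaders by rewrite /= !inE; lia.
have free : coset_free m n Lc.
  by apply: large_leaders_free sub; move: uL; rewrite -LE cat_uniq => /andP[].
have compl := defset1_compl LE hLc hLr hd.
rewrite -[bch_defset _ _ _]setCK cardsCs card_ord setCK; congr (_ - _).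
rewrite (@card_nat_seq _ _ [:: 0, 2 * w + 1, 4 * w + 2 & coset_seq m n Lc]).
- by rewrite /= size_coset_seq; lia.
- rewrite /= (uniq_coset_seq m_gt0 nE free) !inE.
  have nin z : z < n -> {in Lc, forall l, ~ same_coset n l z} -> z \notin coset_seq m n Lc.
    by move=> zn hz; apply/negP=> /(mem_coset_seq m_gt0 nE Lc zn)[l lc /(hz l lc)].
  have lb l : l \in Lc -> 0 < l <= w.
    by move/sub; rewrite !inE => /or3P[]/eqP ->; lia.
  have third_nin z : z < n -> same_coset n (2 * w + 1) z -> z \notin coset_seq m n Lc.
    move=> zn z3; apply: nin => // l /lb hl /(same_coset_sym m_gt0 nE) zl.
    by have := same_coset_trans z3 zl; rewrite same_coset_third; lia.
  have nin0 : 0 \notin coset_seq m n Lc.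
    by apply: nin => [|l /lb hl /(same_coset_sym m_gt0 nE)]; rewrite ?same_coset0; lia.
  rewrite (negPf nin0) !(negPf (third_nin _ _ _)) ?same_coset_third; lia.
- move=> k; rewrite !inE => /or4P[/eqP->|/eqP->|/eqP->|/(coset_seq_lt nE)//]; lia.
by move=> k; rewrite inE compl.
Qed.

Lemma defset1_full delta : 2 * w + 1 < delta ->
  forall k : 'I_n, 0 < k -> k \in bch_defset n 1 delta.
Proof.
move=> hd k k0; have hk : 0 < k < n by rewrite k0 /=.
have nbig := n_large.
have [a [a0 an ak]] := fold_same_coset hk.
apply/(mem_defset1 m_gt0 nE).
case: (large_leaders_cover a0 an) => [[y hy ya]|[l lL la]].
  by exists y; [lia | exact: same_coset_trans ya ak].
exists l; last exact: same_coset_trans la ak.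
by move: lL; rewrite !inE => /or4P[]/eqP ->; lia.
Qed.

(** No leader lies between [delta] and [d], so the run of zeros continues up to d - 1; this lifts
    the distance bound from [delta] to [dlt n i]. *)
Lemma defset1_below_leaders delta Lc Lr d : Lc ++ Lr = large_leaders ->
    {in Lc, forall l, d <= l} -> {in Lr, forall l, l < delta} ->
    w - 8 <= delta -> d <= 2 * w + 1 ->
  forall x, 0 < x < d -> exists2 y, 0 < y < delta & same_coset n y x.
Proof.
move=> LE hLc hLr hd hd2 x /andP[x0 xd]; have nbig := n_large.
case: (large_leaders_cover x0 _) => [|[y hy yx]|[l lL lx]]; first lia.
  by exists y => //; lia.
move: lL; rewrite in_cons => /orP[/eqP lE|].
  by move: lx; rewrite lE same_coset_third; lia.
rewrite -LE mem_cat => /orP[lc|lr].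
  have lL : l \in large_leaders by rewrite -LE mem_cat lc.
  by have := large_leader_min lL x0 lx; have := hLc l lc; lia.
exists l => //; rewrite hLr // andbT.
have : l \in large_leaders by rewrite -LE mem_cat lr orbT.
by rewrite !inE => /or3P[]/eqP ->; lia.
Qed.

Lemma defset1_dlt delta i : 1 <= i <= 4 -> dlt n i.+1 + 2 <= delta <= dlt n i ->
  [/\ #|bch_defset n 1 delta| = n - (2 * m * (i - 1) + 3),
      forall x, 0 < x < dlt n i -> exists2 y, 0 < y < delta & same_coset n y x,
      0 < delta <= n & dlt n i <= n].
Proof.
have nbig := n_large; move=> hi.
have split_at Lc Lr d : Lc ++ Lr = large_leaders ->
    {in Lc, forall l, d <= l} -> {in Lr, forall l, l < delta} ->
    w - 8 <= delta -> delta <= d -> d <= 2 * w + 1 ->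
    [/\ #|bch_defset n 1 delta| = n - (2 * m * size Lc + 3),
        forall x, 0 < x < d -> exists2 y, 0 < y < delta & same_coset n y x,
        0 < delta <= n & d <= n].
  move=> LE hLc hLr hd1 hd2 hd3; split; try lia; last first.
    exact: defset1_below_leaders LE hLc hLr hd1 hd3.
  apply: card_defset_large LE _ hLr _; last by rewrite hd1 (leq_trans hd2).
  by move=> l /hLc; apply: leq_trans.
have [d1 d2 d3 d4 d5] : [/\ dlt n 1 = 2 * w + 1, dlt n 2 = w, dlt n 3 = w - 2,
    dlt n 4 = w - 8 & dlt n 5 = w - 10] by split=> /=; lia.
have w_big : 18 < w by lia.
have /or4P : [|| i == 1, i == 2, i == 3 | i == 4] by lia.
clear hi nbig nE m_odd m_ge11 m_gt0.
case=> /eqP ->; rewrite ?d1 ?d2 ?d3 ?d4 ?d5 => hd.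
(* In the i-th case exactly i - 1 leaders remain in the complement. *)
- by apply: (split_at [::] large_leaders) => //; try (move=> l; rewrite !inE); lia.
- by apply: (split_at [:: w] [:: w - 2; w - 8]) => //; try (move=> l; rewrite !inE); lia.
- by apply: (split_at [:: w; w - 2] [:: w - 8]) => //; try (move=> l; rewrite !inE); lia.
- by apply: (split_at large_leaders [::]) => //; try (move=> l; rewrite !inE); lia.
Qed.

End LargeLeaders.

(** * Parameters of the codes *)

Section Codes.
Variables (m n : nat) (F : fieldType) (xi : F).
Hypotheses (m_gt0 : 0 < m) (nE : n = 2 ^ m + 1).
Hypotheses (hF : (2 \in [pchar F])%R) (hxi : (n.-primitive_root xi)%R).
Variables delta d : nat.
Hypothesis delta_bounds : 0 < delta <= n.
Hypothesis zeros : forall x, 0 < x < d -> exists2 y, 0 < y < delta & same_coset n y x.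

Let odd_n : odd n. Proof. exact: n_odd nE. Qed.

(** The zeros 1, .., d - 1 are mirrored to n - 1, .., n - d + 1 because -1 is a power of 2. *)
Lemma mem_code_defset0 i : i < n -> (i < d) || (n - d < i) ->
  forall k : 'I_n, k = i :> nat -> k \in bch_defset n 0 delta.+1.
Proof.
move=> ltin hi k kE; case/andP: delta_bounds => d0 dn.
rewrite (mem_defset0 m_gt0 nE) //; have [//|k0 /=] := posnP k.
case/orP: hi => hi.
  by apply/(mem_defset1 m_gt0 nE); apply: zeros; rewrite kE hi -kE k0.
have hx : 0 < n - i < d by lia.
have [y hy yx] := zeros hx; apply/(mem_defset1 m_gt0 nE); exists y => //.
apply: same_coset_trans yx _; apply: (@eq_mod_opp_coset m n m_gt0 nE _ 0).
by right; rewrite muln1 kE subnK // ltnW.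
Qed.

Lemma mem_code_eval D (c : 'rV['F_2]_n) (k : 'I_n) :
  c \in cyclic_code xi D -> k \in D -> word_eval xi c k = 0%R.
Proof. by rewrite inE => /forallP/(_ k)/implyP H /H/eqP. Qed.

Lemma bch_code1_params :
  code_params_ge (bch_code n xi delta 1) (n - #|bch_defset n 1 delta|) d.
Proof.
split.
  by apply: (code_dim_cyclic hF hxi) => // i j; apply: defset1_double m_gt0 nE _ _ _.
move=> c cC c0; apply: (bch_bound hF hxi (b := 1) c0) => k kd.
have n0 : 0 < n by rewrite nE addn1.
rewrite -(word_eval_mod hxi); have lt1k : (1 + k) %% n < n by rewrite ltn_pmod.
apply: (mem_code_eval (k := Ordinal lt1k) cC).
have hx : 0 < 1 + k < d by lia.
have [y hy yx] := zeros hx; apply/(mem_defset1 m_gt0 nE); exists y => //.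
by apply: same_coset_trans yx _; exists 0; rewrite muln1 /= modn_mod.
Qed.

Lemma bch_code0_params : d <= n ->
  code_params_ge (bch_code n xi delta.+1 0) (n - #|bch_defset n 1 delta|.+1) (2 * d).
Proof.
move=> dn; case/andP: (delta_bounds) => delta0 _; split.
  rewrite -(card_defset0 m_gt0 nE) //.
  by apply: (code_dim_cyclic hF hxi) => // i j; apply: defset0_double m_gt0 nE _ _ _ delta0.
have n0 : 0 < n by rewrite nE addn1.
have [->|d0] := posnP d; first by [].
(* The 2 d - 1 consecutive zeros start at -(d - 1), represented by n - (d - 1), and pass through
   0. *)
move=> c cC c0; apply: (bch_bound hF hxi (b := n - d.-1) c0) => k kd.
rewrite -(word_eval_mod hxi); have ltk : (n - d.-1 + k) %% n < n by rewrite ltn_pmod.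
apply: (mem_code_eval (k := Ordinal ltk) cC).
apply: (mem_code_defset0 ltk) => //.
have [small|large] := ltnP (n - d.-1 + k) n; first by rewrite modn_small; lia.
rewrite (_ : n - d.-1 + k = k - d.-1 + n); last lia.
rewrite modnDr; apply/orP; left; apply: leq_ltn_trans (leq_mod _ _) _; lia.
Qed.

End Codes.

Lemma wt_le n (c : 'rV['F_2]_n) : wt c <= n.
Proof. by rewrite -[X in _ <= X]card_ord max_card. Qed.

(** Positive dimension supplies a nonzero word, and no weight exceeds [n]. *)
Lemma code_params_ge_eq n (C : {set 'rV['F_2]_n}) k :
  code_params_ge C k.+1 n -> code_params_eq C k.+1 n.
Proof.
move=> CP; split=> //; case: CP => dimC wtC.
have [c cC c0] : exists2 c, c \in C & c != 0%R.
  apply/exists_inP; apply: contraPT dimC; rewrite negb_exists_in => /forall_inP C0.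
  have : (<<enum C>> <= 0)%VS.
    by apply/span_subvP=> c; rewrite mem_enum memv0 => /C0; rewrite negbK.
  by rewrite /code_dim subv0 => /eqP ->; rewrite dimv0.
by exists c => //; rewrite c0 eqn_leq wt_le wtC.
Qed.

Theorem theorem3p7 (t m n : nat) (hm : m = (2 * t + 1)%N) (hm11 : (11 <= m)%N)
  (hn : n = (2 ^ m + 1)%N)
  (F : fieldType) (hF : (2%N \in [pchar F])%R) (xi : F) (hxi : (n.-primitive_root xi)%R)
  (delta : nat) (hodd : odd delta) :
  (* (1) narrow-sense BCH code C(n,2,delta,1) *)
  ( ((2 ^ t.+1 + 3 <= delta <= 2 ^ t.+1 + 2 ^ t - 3)%N ->
       code_params_ge (bch_code n xi delta 1) (n - m * delta + 5 * m) delta)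
  /\ ((2 ^ t.+1 + 2 ^ t + 3 <= delta <= 2 ^ t.+2 - 9)%N ->
       code_params_ge (bch_code n xi delta 1) (n - m * delta + 9 * m) delta)
  /\ ((2 ^ t.+2 - 7 <= delta <= 2 ^ t.+2 + 9)%N ->
       code_params_ge (bch_code n xi delta 1) (n - 2 ^ t.+2 * m + 16 * m)
         (2 ^ t.+2 + 9))
  /\ (forall i : nat, (1 <= i <= 4)%N ->
       (dlt n i.+1 + 2 <= delta <= dlt n i)%N ->
       code_params_ge (bch_code n xi delta 1) (2 * m * (i - 1) + 3) (dlt n i))
  /\ ((dlt n 1 + 2 <= delta <= n)%N ->
       code_params_eq (bch_code n xi delta 1) 1 n) )
  /\
  (* (2) BCH code C(n,2,delta+1,0) *)
  ( ((2 ^ t.+1 + 3 <= delta <= 2 ^ t.+1 + 2 ^ t - 3)%N ->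
       code_params_ge (bch_code n xi delta.+1 0) (2 ^ m - m * delta + 5 * m)
         (2 * delta))
  /\ ((2 ^ t.+1 + 2 ^ t + 3 <= delta <= 2 ^ t.+2 - 9)%N ->
       code_params_ge (bch_code n xi delta.+1 0) (2 ^ m - m * delta + 9 * m)
         (2 * delta))
  /\ ((2 ^ t.+2 - 7 <= delta <= 2 ^ t.+2 + 9)%N ->
       code_params_ge (bch_code n xi delta.+1 0) (2 ^ m - 2 ^ t.+2 * m + 16 * m)
         (2 * (2 ^ t.+2 + 9)))
  /\ (forall i : nat, (1 <= i <= 4)%N ->
       (dlt n i.+1 + 2 <= delta <= dlt n i)%N ->
       code_params_ge (bch_code n xi delta.+1 0) (2 * m * (i - 1) + 2)
         (2 * dlt n i)) ).
Proof.
have m_gt0 : 0 < m by lia.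
have t_ge5 : 5 <= t by lia.
pose H := 2 ^ (t - 1); have HE : H = 2 ^ (t - 1) by [].
have pt : 2 ^ t = 2 * H by rewrite HE -expnS; congr (_ ^ _); lia.
have pt1 : 2 ^ t.+1 = 4 * H by rewrite expnS pt; lia.
have pt2 : 2 ^ t.+2 = 8 * H by rewrite expnS pt1; lia.
have H16 : 16 <= H by rewrite HE; apply: (@leq_pexp2l 2 4); lia.
have tH : 2 * t + 1 <= H.
  rewrite HE; have -> : t = (t - 5) + 5 by lia.
  move: (t - 5) => u; rewrite -addnBA // expnD; elim: u => // u; rewrite expnS; lia.
have pm : 2 ^ m = 8 * (H * H) by rewrite hm mul2n -addnn !expnD pt; lia.
(* Keeps the truncated subtractions in the dimension formulas exact. *)
have mH : m * (8 * H) <= 2 ^ m.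
  have : m * (8 * H) <= H * (8 * H) by rewrite leq_mul2r hm tH orbT.
  lia.
have mdelta : delta <= 8 * H -> m * delta <= 2 ^ m.
  by move=> hd; apply: leq_trans mH; rewrite leq_mul2l hd orbT.
have m_odd : odd m by lia.
have Hbig : 16 * H <= H * H by rewrite leq_mul2r H16 orbT.
have [w wE] : exists w, n = 6 * w + 3.
  have [q qE] := pow2_mod3 m; exists (q %/ 2).
  have : odd n by apply: n_odd hn.
  lia.
have d1E : dlt n 1 = 2 * w + 1 by rewrite /=; lia.
have case1 : 2 ^ t.+1 + 3 <= delta <= 2 ^ t.+1 + 2 ^ t - 3 ->
    #|bch_defset n 1 delta| + 5 * m = m * delta.
  move=> hd; rewrite (card_defset_small t_ge5 hm hn HE (d0 := delta)); [|lia..].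
  rewrite -[in RHS](size_small_leaders1 t_ge5 hm hn HE hodd hd); lia.
have case2 : 2 ^ t.+1 + 2 ^ t + 3 <= delta <= 2 ^ t.+2 - 9 ->
    #|bch_defset n 1 delta| + 9 * m = m * delta.
  move=> hd; rewrite (card_defset_small t_ge5 hm hn HE (d0 := delta)); [|lia..].
  have hd1 : 2 ^ t.+1 + 2 ^ t + 3 <= delta by case/andP: hd.
  rewrite -[in RHS](size_small_leaders2 t_ge5 hm hn HE hodd hd1); lia.
have case3 : 2 ^ t.+2 - 7 <= delta <= 2 ^ t.+2 + 9 ->
    #|bch_defset n 1 delta| + 16 * m = 2 ^ t.+2 * m.
  move=> hd; rewrite (card_defset_small t_ge5 hm hn HE (d0 := 2 ^ t.+2 - 7)); [|lia..].
  have o7 : odd (2 ^ t.+2 - 7) by lia.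
  have h7 : 2 ^ t.+1 + 2 ^ t + 3 <= 2 ^ t.+2 - 7 by lia.
  have := size_small_leaders2 t_ge5 hm hn HE o7 h7.
  move: (size _) => u uE; rewrite (_ : 2 ^ t.+2 = 2 * u + 16); lia.
have zeros3 : 2 ^ t.+2 - 7 <= delta <= 2 ^ t.+2 + 9 -> forall x, 0 < x < 2 ^ t.+2 + 9 ->
    exists2 y, 0 < y < delta & same_coset n y x.
  move=> hd x /andP[x0 xd].
  have [|l] := small_leaders_cover t_ge5 hm hn HE x0 (d := 2 ^ t.+2 - 7); first by right.
  rewrite mem_small_leaders => /and3P[ol _ ld] lx; exists l => //.
  by case: (posnP l) ol => [->//|]; lia.
have trivial_zeros x : 0 < x < delta -> exists2 y, 0 < y < delta & same_coset n y x.
  by exists x => //; apply: same_coset_refl.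
have delta_n : delta <= 8 * H + 9 -> 0 < delta <= n.
  by rewrite hn pm; case: (delta) hodd; lia.
have large := defset1_dlt m_odd hm11 hn wE.
have dim_sub k a b c : a + c = b -> b <= k -> k - b + c = k - a.
  by clear; lia.
have le_n k : k <= 2 ^ m -> k <= n by rewrite hn addn1 => /leqW.
(* The extra zero at 0 costs one dimension, turning [n] into 2^m. *)
have nS k : n - k.+1 = 2 ^ m - k by rewrite hn addn1 subSS.
have m8 : 2 ^ t.+2 * m <= 2 ^ m by rewrite pt2 mulnC.
have small_dim i : 1 <= i <= 4 -> 2 * m * (i - 1) + 3 <= n.
  case/andP=> _ hi; have : 2 * m * (i - 1) <= 2 * m * 3.
    by rewrite leq_mul2l leq_subLR hi orbT.
  have : 11 * H <= m * H by rewrite leq_mul2r hm11 orbT.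
  have : m * 16 <= m * H by rewrite leq_mul2l H16 orbT.
  by move: mH; rewrite hn; clear; lia.
have compl_dim x : x + 3 <= n -> n - (n - (x + 3)).+1 = x + 2 by clear; lia.
have range1 : 2 ^ t.+1 + 3 <= delta <= 2 ^ t.+1 + 2 ^ t - 3 -> delta <= 8 * H.
  by rewrite pt1 pt; clear; lia.
have range2 : 2 ^ t.+1 + 2 ^ t + 3 <= delta <= 2 ^ t.+2 - 9 -> delta <= 8 * H.
  by rewrite pt2 pt1 pt; clear; lia.
have range3 : 2 ^ t.+2 - 7 <= delta <= 2 ^ t.+2 + 9 -> delta <= 8 * H + 9.
  by rewrite pt2; case/andP.
have le9 k : k <= 8 * H -> k <= 8 * H + 9 by move/leq_trans; apply; rewrite leq_addr.
have d9_n : 2 ^ t.+2 + 9 <= n by rewrite pt2 hn pm; move: H16 Hbig; clear; lia.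
split; split; [| split; [|split; [|split]] | | split; [|split]].
- move=> hd; rewrite (dim_sub n _ _ _ (case1 hd)) ?le_n ?mdelta ?range1 //.
  by apply: (bch_code1_params m_gt0 hn) => //; apply/delta_n/le9/range1.
- move=> hd; rewrite (dim_sub n _ _ _ (case2 hd)) ?le_n ?mdelta ?range2 //.
  by apply: (bch_code1_params m_gt0 hn) => //; apply/delta_n/le9/range2.
- move=> hd; rewrite (dim_sub n _ _ _ (case3 hd)) ?le_n //.
  by apply: (bch_code1_params m_gt0 hn) => //; [apply/delta_n/range3 | exact: zeros3].
- move=> i hi hd; have [cD zD hdn hin] := large delta i hi hd.
  rewrite -[_ + 3](subKn (small_dim i hi)) -cD.
  exact: (bch_code1_params m_gt0 hn hF hxi hdn zD).
- rewrite d1E => hd; apply: code_params_ge_eq.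
  have hd1 : 2 * w + 1 < delta by case/andP: hd; rewrite addn2 => /ltnW.
  have dn : delta <= n by case/andP: hd.
  have full := defset1_full m_odd hm11 hn wE hd1.
  have n0 : 0 < n by rewrite hn addn1.
  have dimE : n - #|bch_defset n 1 delta| = 1.
    (* Beyond n / 3 every nonzero index is a zero, leaving dimension 1. *)
    have -> : bch_defset n 1 delta = [set~ Ordinal n0].
      apply/setP=> k; rewrite !inE -val_eqE /= -lt0n; apply/idP/idP; last exact: full.
      by move/(defset1_neq0 m_gt0 hn dn).
    by rewrite cardsC1 card_ord -subn1 subKn.
  have dn0 : 0 < delta <= n by rewrite dn andbT (leq_trans _ hd1).
  have zeros x : 0 < x < n -> exists2 y, 0 < y < delta & same_coset n y x.
    by case/andP=> x0 xn; apply/(mem_defset1 m_gt0 hn delta (Ordinal xn))/full.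
  by have := bch_code1_params m_gt0 hn hF hxi dn0 zeros; rewrite dimE.
- move=> hd; rewrite (dim_sub _ _ _ _ (case1 hd)) ?mdelta ?range1 // -nS.
  have dn := delta_n (le9 _ (range1 hd)).
  by apply: (bch_code0_params m_gt0 hn) => //; case/andP: dn.
- move=> hd; rewrite (dim_sub _ _ _ _ (case2 hd)) ?mdelta ?range2 // -nS.
  have dn := delta_n (le9 _ (range2 hd)).
  by apply: (bch_code0_params m_gt0 hn) => //; case/andP: dn.
- move=> hd; rewrite (dim_sub _ _ _ _ (case3 hd)) // -nS.
  by apply: (bch_code0_params m_gt0 hn) => //; [apply/delta_n/range3 | exact: zeros3].
move=> i hi hd; have [cD zD hdn hin] := large delta i hi hd.
rewrite -compl_dim ?small_dim // -cD.
exact: (bch_code0_params m_gt0 hn hF hxi hdn zD hin).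
Qed.
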